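(* Let $\ell$ be a finite linear order with $|\ell|\ge 2$, and let $\mathscr T$ be a Schröder tree on $\ell$ enriched with connected graphs (every $g_v$ connected), with root $r$ and $g=\bigvee\mathscr T$. Then $$\sigma(L(g))=\Big(\prod_{w\in\mathrm{Iv}(\mathscr T),\,w\neq r}\varphi_{N_{rw}}\big(\sigma(\mathscr L(g_w))\big)\Big)\cdot\sigma(\mathscr L(g_r)).$$
   Context: All graphs are finite and simple; $L(g)$ is the Laplacian matrix. Spectra are multisets written multiplicatively (product = multiset union). Segmented partitions and generalized composition: for a finite linear order $\ell$, a segmented partition is a tuple $\pi=(\ell_1,\dots,\ell_k)$ of nonempty consecutive segments whose concatenation is $\ell$; given graphs $g_{\ell_j}$ on $\ell_j$ and a graph $h$ on vertex set $\pi$, $\bigvee_h(g_{\ell_1},\dots,g_{\ell_k})$ is the graph on $\ell$ whose edges are those of the $g_{\ell_j}$ together with all $\{x,y\}$, $x\in\ell_i$, $y\in\ell_j$, for $\{\ell_i,\ell_j\}\in E(h)$. Graph-enriched Schröder trees: a rooted plane tree whose leaves, read left to right, are the elements of $\ell$, each internal vertex having at least two children, together with for each internal vertex $v$ a simple graph $g_v$ on vertex set $\pi_v=(\ell_{v_1},\dots,\ell_{v_k})$, where $v_1,\dots,v_k$ are the children of $v$ left to right and $\ell_u$ is the set of leaves descending from $u$ ($\ell_u=\{u\}$ for a leaf). $\mathrm{Iv}(\mathscr T)$ is the set of internal vertices; $\mathscr T_u$ the subtree rooted at $u$; $\bigvee\mathscr T$ is defined recursively ($\bigvee$ of a single leaf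 is the one-vertex graph, otherwise $\bigvee\mathscr T=\bigvee_{g_r}(\bigvee\mathscr T_{r_1},\dots,\bigvee\mathscr T_{r_k})$). The matrix $\mathscr L(g_v)$: with $n_i=|\ell_{v_i}|$ and $N_i=\sum_{s:\{\ell_{v_s},\ell_{v_i}\}\in E(g_v)}n_s$, it is the $k\times k$ matrix with diagonal entries $N_i$ and $(i,j)$ entry ($i\ne j$) equal to $-\sqrt{n_in_j}$ if $\{\ell_{v_i},\ell_{v_j}\}\in E(g_v)$ and $0$ otherwise. External valencies: for a non-root internal vertex $w$ with parent $u$, $N_w=\sum_{x:\{\ell_x,\ell_w\}\in E(g_u)}|\ell_x|$; if $r=w_0,w_1,\dots,w_m=w$ is the path from the root to $w$, then $N_{rw}=N_{w_1}+\cdots+N_{w_m}$. The shift operator: for a finite multiset $\omega$ of reals and $s\in\mathbb R$, $\varphi_s(\omega)$ is obtained by removing one occurrence of $0$ from $\omega$ if $0\in\omega$ (and removing nothing otherwise), and then adding $s$ to every remaining element. *)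

(* Defs.v *)
From mathcomp Require Import all_boot all_order all_algebra.
From mathcomp Require Import polyrcf.
Set Implicit Arguments.
Unset Strict Implicit.
Unset Printing Implicit Defensive.
Import Order.TTheory GRing.Theory Num.Theory.
Local Open Scope ring_scope.

(* Graph-enriched Schroeder trees.  A node carries the ordered list of its
   children (left to right) and a relation on child indices 0..k-1 giving the
   graph g_v on pi_v = (l_{v_1},...,l_{v_k}).  The leaves, read left to
   right, are identified with the positions 0..n-1 of the linear order l. *)
Inductive stree : Type :=
| SLeaf : stree
| SNode : seq stree -> (nat -> nat -> bool) -> stree.

Fixpoint nleaves (t : stree) : nat :=
  match t with
  | SLeaf => 1%N
  | SNode cs _ => sumn (map nleaves cs)
  end.

Definition simple_on (k : nat) (e : nat -> nat -> bool) : bool :=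
  [forall i : 'I_k, forall j : 'I_k, (e i j == e j i) && ~~ e i i].

Definition connected_on (k : nat) (e : nat -> nat -> bool) : bool :=
  [forall i : 'I_k, forall j : 'I_k, connect (fun a b : 'I_k => e a b) i j].

Fixpoint wf_conn (t : stree) : bool :=
  match t with
  | SLeaf => true
  | SNode cs e =>
      [&& (2 <= size cs)%N, all wf_conn cs, simple_on (size cs) e
        & connected_on (size cs) e]
  end.

Definition boff (ns : seq nat) (i : nat) : nat := sumn (take i ns).
Definition bidx (ns : seq nat) (x : nat) : nat :=
  find (fun k => (x < sumn (take k.+1 ns))%N) (iota 0 (size ns)).

Fixpoint adjT (t : stree) : nat -> nat -> bool :=
  match t with
  | SLeaf => fun _ _ => false
  | SNode cs e =>
      let ns := map nleaves cs in
      let fs := map adjT cs in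
      fun x y =>
        let i := bidx ns x in
        let j := bidx ns y in
        if i == j then nth (fun _ _ => false) fs i (x - boff ns i)%N (y - boff ns i)%N
        else e i j
  end.

Definition laplacian (R : nzRingType) (n : nat) (adj : nat -> nat -> bool)
  : 'M[R]_n :=
  \matrix_(i, j) (if i == j then (#|[set k : 'I_n | adj i k]|)%:R
                  else if adj i j then -1 else 0).

Section Spec.
Variable R : rcfType.

(* multiset of (real) roots with multiplicity of the characteristic
   polynomial, i.e. the spectrum of a real symmetric matrix *)
Definition spectrum (n : nat) (M : 'M[R]_n) : seq R :=
  let p := char_poly M in
  flatten [seq nseq (mup x p) x | x <- rootsR p].

Definition Nval (cs : seq stree) (e : nat -> nat -> bool) (i : nat) : R :=
  \sum_(x < size cs | (x != i :> nat) && e x i) (nleaves (nth SLeaf cs x))%:R.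

Definition calL (cs : seq stree) (e : nat -> nat -> bool) : 'M[R]_(size cs) :=
  \matrix_(i, j)
    (if i == j then Nval cs e i
     else if e i j then - Num.sqrt ((nleaves (nth SLeaf cs i)
                                     * nleaves (nth SLeaf cs j))%:R)
     else 0).

Definition phi (s : R) (w : seq R) : seq R :=
  map (fun x => x + s) (if 0 \in w then rem 0 w else w).

(* contributions of the internal vertices of the subtree t, where s is
   N_{r t} (external valency accumulated from the root); at the root
   (isroot = true) no shift is applied. *)
Fixpoint contrib (isroot : bool) (t : stree) (s : R) : seq R :=
  match t with
  | SLeaf => [::]
  | SNode cs e =>
      (if isroot then spectrum (calL cs e) else phi s (spectrum (calL cs e)))
      ++ (fix go (l : seq stree) (i : nat) : seq R :=
            match l with
            | [::] => [::]
            | c :: l' => contrib false c (s + Nval cs e i) ++ go l' i.+1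
            end) cs 0%N
  end.

Definition rhs_spectrum (t : stree) : seq R := contrib true t 0.

End Spec.

(* Main.v *)
Require Import Defs.
From mathcomp Require Import all_boot all_order all_algebra.
From mathcomp Require Import polyrcf complex ring.
Import Order.TTheory GRing.Theory Num.Theory.
Local Open Scope ring_scope.

(** At an internal vertex with children c_i, X - L is D + Z W, where D is block
    diagonal with blocks (X - N_i) - L(c_i), Z holds the indicator vectors of the
    blocks, and W records the adjacencies between blocks.  Each Laplacian
    kills the all-ones vector, so D Z = Z C with C = diag(X - N_i), and a Schur
    complement identity reduces \det (D + Z W) to \det D and to the k x k
    determinant \det (C + W Z), which conjugation by diag (sqrt n_i) turns into
    the characteristic polynomial of calL.  Hence P_t(X) \prod (X - N_i) =
    \prod P_{c_i}(X - N_i) * P_calL(X), and the spectra follow by induction on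
    the tree, because real symmetric matrices have split characteristic
    polynomials; the factors X - N_i are the zeros removed by phi. *)

(** * Linear algebra: spectra of symmetric matrices and a Schur complement identity *)

(** With [w] the conjugate of an eigenvector [v], computing [v M w^T] in two ways gives
    [conj a = a], since [v w^T] is a sum of squared moduli and hence nonzero. *)
Lemma symmetric_eigenvalue_real (R : rcfType) n (M : 'M[R]_n) (a : R[i]) :
  M^T = M -> eigenvalue (map_mx (real_complex R) M) a -> a \is Num.real.
Proof.
move=> Msym /eigenvalueP[v va v_neq0].
set MC := map_mx _ M in va.
pose w := map_mx Num.conj v.
have wa : w *m MC = Num.conj a *: w.
  rewrite -map_mxZ -va map_mxM; congr (_ *m _).
  by apply/matrixP=> i j; rewrite !mxE; apply/esym/CrealP/complex_realP; exists (M i j).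
have MCsym : MC^T = MC by rewrite map_trmx Msym.
have := congr1 (fun u => u *m w^T) va.
rewrite /= -mulmxA -[X in X *m w^T]MCsym -trmx_mul wa linearZ /= -scalemxAr.
rewrite -scalemxAl => /eqP; rewrite -subr_eq0 -scalerBl scaler_eq0.
case/orP=> [/eqP/subr0_eq/eqP aR|/eqP/matrixP/(_ 0 0)]; first exact/CrealP/eqP.
rewrite !mxE => /eqP; rewrite psumr_eq0 => [/allP v0|i _]; last first.
  by rewrite !mxE mul_conjC_ge0.
case/eqP: v_neq0; apply/rowP=> i; rewrite mxE.
by have := v0 i (mem_index_enum _); rewrite !mxE mul_conjC_eq0 => /eqP.
Qed.

Lemma symmetric_char_poly_splits (R : rcfType) n (M : 'M[R]_n) :
  M^T = M -> exists s : seq R, char_poly M = \prod_(x <- s) ('X - x%:P).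
Proof.
move=> Msym.
have [r] := closed_field_poly_normal (char_poly (map_mx (real_complex R) M)).
rewrite (monicP (char_poly_monic _)) scale1r => pE.
have rR x : x \in r -> real_complex R (complex.Re x) = x.
  move=> xr; apply/RRe_real/(symmetric_eigenvalue_real _ _ _ _ Msym).
  by rewrite eigenvalue_root_char pE root_prod_XsubC.
exists [seq complex.Re x | x <- r].
apply: (map_poly_inj (real_complex R)); rewrite map_char_poly pE rmorph_prod.
rewrite big_map; apply: eq_big_seq => x /rR xE.
by rewrite rmorphB /= map_polyX map_polyC /= xE.
Qed.

(** Both lists contain each [x] as often as its multiplicity as a root. Equality of spectra thereby
    becomes an identity of polynomials. *)
Lemma spectrum_of_splits (R : rcfType) n (M : 'M[R]_n) (s : seq R) :
  char_poly M = \prod_(x <- s) ('X - x%:P) -> perm_eq (spectrum M) s.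
Proof.
move=> pE; rewrite /spectrum pE; set p := \prod_(x <- s) _.
have p_neq0 : p != 0 by rewrite monic_neq0 ?monic_prod_XsubC.
apply/allP => x _ /=; apply/eqP; rewrite -(mu_prod_XsubC x s) -/p.
rewrite count_flatten -map_comp sumnE big_map.
under eq_bigr do rewrite /= count_nseq /=.
have [xr|xNr] := boolP (x \in rootsR p).
  rewrite (bigD1_seq x) ?uniq_roots //= eqxx mul1n big1 ?addn0 // => y yx.
  by rewrite (negPf yx).
rewrite big_seq big1 => [|y yr]; last first.
  by case: eqP => // yx; rewrite -yx yr in xNr.
rewrite mupNroot //; apply: contra xNr => xp.
by have := roots_on_rootsR p_neq0 x; rewrite in_itv /= xp => <-.
Qed.

Lemma symmetric_spectrum_prod (R : rcfType) n (M : 'M[R]_n) :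
  M^T = M -> \prod_(x <- spectrum M) ('X - x%:P) = char_poly M.
Proof.
move=> /symmetric_char_poly_splits[s pE]; rewrite pE.
exact/perm_big/spectrum_of_splits.
Qed.

(* If the columns of Z span a D-stable submodule, on which D acts by C, the
   Schur complement formula needs no invertibility. *)
Lemma det_add_mul_stable (S : comNzRingType) n k (D : 'M[S]_n)
    (Z : 'M[S]_(n, k)) (W : 'M[S]_(k, n)) (C : 'M[S]_k) :
  D *m Z = Z *m C -> \det (D + Z *m W) * \det C = \det D * \det (C + W *m Z).
Proof.
(* Two right multiplications make [B] block triangular: one clears the corner [W], the other clears
   [- Z] because [D Z = Z C]. *)
move=> DZ; pose B := block_mx D (- Z) W 1%:M.
have -> : \det (D + Z *m W) = \det B.
  have := det_ublock (D + Z *m W) (- Z) (1%:M : 'M_k); rewrite det1 mulr1 => <-.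
  have -> : block_mx (D + Z *m W) (- Z) 0 1%:M = B *m block_mx 1%:M 0 (- W) 1%:M.
    by rewrite mulmx_block !mulmx1 !mulmx0 !mulNmx !mulmxN opprK !mul1mx addrN !add0r.
  by rewrite det_mulmx det_lblock !det1 !mulr1.
have <- : \det (block_mx 1%:M Z 0 C) = \det C by rewrite det_ublock det1 mul1r.
rewrite -det_mulmx mulmx_block !mulmx1 !mulmx0 !addr0 mul1mx mulNmx DZ subrr.
by rewrite det_lblock [W *m Z + C]addrC.
Qed.

(** * Block coordinates: sums and determinants over a concatenation of blocks *)

Definition bpos (ns : seq nat) (x : nat) : nat := (x - boff ns (bidx ns x))%N.

Lemma bidx_cons n ns x :
  bidx (n :: ns) x = if (x < n)%N then 0%N else (bidx ns (x - n)).+1.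
Proof.
rewrite /bidx /= take0 /= addn0; case: ltnP => // nx; congr _.+1.
rewrite (iotaDl 1 0) find_map; apply: eq_find => k /=.
by rewrite -[in LHS](subnKC nx) ltn_add2l.
Qed.

Lemma bpos_cons n ns x :
  bpos (n :: ns) x = if (x < n)%N then x else bpos ns (x - n).
Proof.
rewrite /bpos bidx_cons /boff; case: ifP => _ /=; first by rewrite subn0.
by rewrite subnDA.
Qed.

Lemma bidx_lt ns x : (x < sumn ns)%N -> (bidx ns x < size ns)%N.
Proof.
elim: ns x => [|n ns IHns] x //= xlt; rewrite bidx_cons; case: (ltnP x n) => // nx.
by rewrite ltnS IHns // ltn_subLR.
Qed.

Lemma bpos_lt ns x : (x < sumn ns)%N -> (bpos ns x < nth 0%N ns (bidx ns x))%N.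
Proof.
elim: ns x => [|n ns IHns] x //= xlt.
rewrite bidx_cons bpos_cons; case: (ltnP x n) => // nx.
by rewrite IHns // ltn_subLR.
Qed.

Lemma bidx_bpos_inj ns x y :
  bidx ns x = bidx ns y -> bpos ns x = bpos ns y ->
  (x < sumn ns)%N -> (y < sumn ns)%N -> x = y.
Proof.
elim: ns x y => [|n ns IHns] x y //=; rewrite !bidx_cons !bpos_cons.
case: (ltnP x n) => nx; case: (ltnP y n) => ny // [eq_i] eq_p xlt ylt.
by rewrite -(subnKC nx) -(subnKC ny) (IHns _ _ eq_i eq_p) // ltn_subLR.
Qed.

(** [G] takes naturals, not ordinals, so that the induction can shift the block index. *)
Lemma sum_blocks (S : nmodType) (ns : seq nat) (G : nat -> nat -> S) :
  \sum_(x < sumn ns) G (bidx ns x) (bpos ns x)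
    = \sum_(i < size ns) \sum_(a < nth 0%N ns i) G i a.
Proof.
elim: ns G => [|n ns IHns] G; first by rewrite !big_ord0.
rewrite big_split_ord big_ord_recl /=; congr (_ + _).
  by apply: eq_bigr => a _; rewrite bidx_cons bpos_cons /= ltn_ord.
rewrite -(IHns (fun i => G i.+1)); apply: eq_bigr => z _ /=.
by rewrite bidx_cons bpos_cons ltnNge leq_addr /= addKn.
Qed.

(** Splitting off the first block leaves zero corners, and the remaining block has the same shape
    with [F] shifted. *)
Lemma det_blocks (S : comNzRingType) (ns : seq nat) (F : nat -> nat -> nat -> S) :
  \det (\matrix_(x < sumn ns, y < sumn ns)
          if bidx ns x == bidx ns y then F (bidx ns x) (bpos ns x) (bpos ns y) else 0)
    = \prod_(i < size ns) \det (\matrix_(a < nth 0%N ns i, b < nth 0%N ns i) F i a b).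
Proof.
elim: ns F => [|n ns IHns] F; first by rewrite big_ord0 det_mx00.
rewrite big_ord_recl /= -(IHns (fun i => F i.+1)) -(det_ublock _ 0).
congr (\det _); apply/matrixP=> x y.
case: (split_ordP x) => x' ->; case: (split_ordP y) => y' ->;
  rewrite ?block_mxEul ?block_mxEur ?block_mxEdl ?block_mxEdr !mxE;
  rewrite !bidx_cons !bpos_cons /= ?ltn_ord ?[(n + _ < n)%N]ltnNge ?leq_addr //=.
by rewrite !addKn eqSS.
Qed.

(** * Adjacency, degrees and Laplacians of trees *)

Lemma stree_nth_ind (P : stree -> Prop) :
  P SLeaf ->
  (forall cs e, (forall i, (i < size cs)%N -> P (nth SLeaf cs i)) -> P (SNode cs e)) ->
  forall t, P t.
Proof.
move=> P0 PS; fix IH 1 => -[|cs e]; first exact: P0.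
apply: PS => i _; elim: cs i => [|c cs IHcs] [|i].
- exact: P0.
- exact: P0.
- exact: IH.
- exact: IHcs.
Qed.

(** [e] is consulted only between distinct blocks, so a loop would have to come from a child; beyond
    all blocks the default relation is empty. *)
Lemma adjT_irreflexive t x : adjT t x x = false.
Proof.
elim/stree_nth_ind: t x => //= cs e IH x; rewrite eqxx.
set i := bidx _ x; have [ics|ics] := ltnP i (size cs).
  by rewrite (nth_map SLeaf) // IH.
by rewrite nth_default // size_map.
Qed.

Lemma wf_nleaves_gt0 t : wf_conn t -> (0 < nleaves t)%N.
Proof.
elim/stree_nth_ind: t => // -[|c cs] e IH //= /and4P[_ /andP[wc _] _ _].
by rewrite addn_gt0 (IH 0%N).
Qed.

(** Irreflexivity kills the adjacency term on the diagonal, so degree minus adjacency covers both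
    cases. *)
Lemma laplacianE (R : nzRingType) n (adj : nat -> nat -> bool) :
  (forall x, adj x x = false) ->
  laplacian R n adj = \matrix_(i, j)
    ((\sum_(k < n) (adj i k)%:R) *+ (i == j :> nat) - (adj i j)%:R).
Proof.
move=> adj_irr; apply/matrixP=> i j; rewrite !mxE -val_eqE /=.
case: eqP => [<-|_]; last by rewrite sub0r; case: (adj i j); rewrite ?oppr0.
by rewrite adj_irr subr0 -natr_sum -sum1_card big_mkcond /=;
   congr _%:R; apply: eq_bigr => k _; rewrite inE; case: (adj i k).
Qed.

Lemma sum_children (S : nmodType) (cs : seq stree) (G : nat -> nat -> S) :
  let ns := map nleaves cs in
  \sum_(x < sumn ns) G (bidx ns x) (bpos ns x)
    = \sum_(i < size cs) \sum_(a < nleaves (nth SLeaf cs i)) G i a.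
Proof.
rewrite /= sum_blocks size_map; apply: eq_bigr => i _.
by rewrite (nth_map SLeaf).
Qed.

Lemma adjT_node cs e x y :
  (bidx (map nleaves cs) x < size cs)%N ->
  adjT (SNode cs e) x y =
    if bidx (map nleaves cs) x == bidx (map nleaves cs) y then
      adjT (nth SLeaf cs (bidx (map nleaves cs) x))
        (bpos (map nleaves cs) x) (bpos (map nleaves cs) y)
    else e (bidx (map nleaves cs) x) (bidx (map nleaves cs) y).
Proof.
move=> ilt /=; case: eqP => // iE.
by rewrite (nth_map SLeaf) // /bpos -iE.
Qed.

Lemma simple_on_sym k e i j :
  simple_on k e -> (i < k)%N -> (j < k)%N -> e i j = e j i.
Proof.
move=> /forallP e_simple ik jk.
by have /forallP/(_ (Ordinal jk))/andP[/eqP] := e_simple (Ordinal ik).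
Qed.

(** Neighbours in the same block are counted by the child; every adjacent block contributes all its
    leaves, which add up to [Nval]. *)
Lemma degree_node (R : rcfType) cs e x (ns := map nleaves cs) (i := bidx ns x) :
  simple_on (size cs) e -> (x < sumn ns)%N ->
  \sum_(y < sumn ns) (adjT (SNode cs e) x y)%:R =
    \sum_(b < nleaves (nth SLeaf cs i)) (adjT (nth SLeaf cs i) (bpos ns x) b)%:R
    + Nval R cs e i.
Proof.
move=> e_simple xlt.
have ilt : (i < size cs)%N by rewrite -(size_map nleaves) bidx_lt.
pose G j b : R := (if i == j then adjT (nth SLeaf cs i) (bpos ns x) b else e i j)%:R.
transitivity (\sum_(y < sumn ns) G (bidx ns y) (bpos ns y)).
  by apply: eq_bigr => y _; rewrite adjT_node.
rewrite sum_children (bigD1 (Ordinal ilt)) //=; congr (_ + _).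
  by apply: eq_bigr => b _; rewrite /G eqxx.
rewrite /Nval big_mkcondr; apply: eq_bigr => j ji /=.
(* [Nval] reads [e] with its arguments in the opposite order to [adjT]. *)
rewrite -(simple_on_sym _ _ i j e_simple) //.
have ij : (i == j) = false by rewrite eq_sym; apply: negPf ji.
under eq_bigr do rewrite /G ij.
by rewrite sumr_const card_ord; case: (e i j); rewrite // mul0rn.
Qed.

(** * The characteristic polynomial at an internal vertex *)

(** With [S] the diagonal matrix of the square roots of the block sizes, [S Q = (X - calL) S]: for
    adjacent blocks both entries are [sqrt(n_i) n_j]. Positive sizes make [\det S] cancellable. *)
Lemma det_quotient (R : rcfType) cs e :
  (forall i, (i < size cs)%N -> (0 < nleaves (nth SLeaf cs i))%N) ->
  \det (\matrix_(i < size cs, j < size cs)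
      (('X - (Nval R cs e i)%:P) *+ (i == j)
        + ((i != j) && e i j)%:R *+ nleaves (nth SLeaf cs j)))
    = char_poly (calL R cs e).
Proof.
move=> n_gt0; set Q := \matrix_(i, j) _.
pose r (i : 'I_(size cs)) : R := Num.sqrt (nleaves (nth SLeaf cs i))%:R.
pose S := diag_mx (\row_i (r i)%:P).
have rr i : r i * r i = (nleaves (nth SLeaf cs i))%:R by rewrite -expr2 sqr_sqrtr ?ler0n.
have S_neq0 : \det S != 0.
  rewrite det_diag prodf_seq_neq0; apply/allP=> i _ /=.
  by rewrite mxE polyC_eq0 sqrtr_eq0 -ltNge ltr0n n_gt0.
apply: (mulfI S_neq0); rewrite [RHS]mulrC -!det_mulmx; congr (\det _).
rewrite mul_diag_mx mul_mx_diag; apply/matrixP=> i j; rewrite !mxE.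
have [<-|ij] := eqVneq i j; first by rewrite mul0rn addr0 !mulr1n mulrC.
rewrite !mulr0n add0r; case: (e i j) => /=; last by rewrite subrr mul0rn mulr0 mul0r.
rewrite sub0r polyCN opprK natrM sqrtrM ?ler0n // -/(r i) -/(r j).
by rewrite polyCM -mulrA -polyCM rr rmorph_nat.
Qed.

Lemma comp_char_polyE (R : comNzRingType) n (L : 'M[R]_n) (q : {poly R}) :
  char_poly L \Po q = \det (\matrix_(a, b) (q *+ (a == b) - (L a b)%:P)).
Proof.
rewrite -[LHS]/(comp_poly q _) -det_map_mx; congr (\det _).
apply/matrixP=> a b; rewrite !mxE rmorphB /= comp_polyC; congr (_ - _).
by rewrite rmorphMn /= comp_polyX.
Qed.

Lemma laplacian_row_sum (R : nzRingType) n (adj : nat -> nat -> bool) (i : 'I_n) :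
  (forall x, adj x x = false) -> \sum_j laplacian R n adj i j = 0.
Proof.
move=> adj_irr; rewrite laplacianE //; under eq_bigr do rewrite mxE.
rewrite sumrB (bigD1 i) //= eqxx mulr1n [X in _ + X - _]big1 ?addr0 ?subrr // => j ji.
by rewrite [i == j :> nat]eq_sym (negPf (ji : j != i :> nat)).
Qed.

Lemma char_poly_node (R : rcfType) cs e :
  (forall i, (i < size cs)%N -> (0 < nleaves (nth SLeaf cs i))%N) ->
  simple_on (size cs) e ->
  char_poly (laplacian R (nleaves (SNode cs e)) (adjT (SNode cs e)))
    * \prod_(i < size cs) ('X - (Nval R cs e i)%:P)
  = (\prod_(i < size cs)
       (char_poly (laplacian R (nleaves (nth SLeaf cs i)) (adjT (nth SLeaf cs i)))
          \Po ('X - (Nval R cs e i)%:P))) * char_poly (calL R cs e).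
Proof.
move=> n_gt0 e_simple; rewrite -det_quotient //.
pose ns := map nleaves cs; pose N i : R := Nval R cs e i.
pose c i := nth SLeaf cs i.
pose Lc i a b : R := (\sum_(k < nleaves (c i)) (adjT (c i) a k)%:R) *+ (a == b)
                     - (adjT (c i) a b)%:R.
pose F i a b : {poly R} := ('X - (N i)%:P) *+ (a == b) - (Lc i a b)%:P.
pose D := \matrix_(x < sumn ns, y < sumn ns)
  if bidx ns x == bidx ns y then F (bidx ns x) (bpos ns x) (bpos ns y) else 0.
pose Z := \matrix_(x < sumn ns, i < size cs) ((bidx ns x == i)%:R : {poly R}).
pose W := \matrix_(i < size cs, y < sumn ns)
  (((i != bidx ns y :> nat) && e i (bidx ns y))%:R : {poly R}).
pose C : 'M[{poly R}]_(size cs) := diag_mx (\row_i ('X - (N i)%:P)).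
have bidx_cs x : (x < sumn ns)%N -> (bidx ns x < size cs)%N.
  by move=> /bidx_lt; rewrite size_map.
have FE i :
    \matrix_(a < nleaves (c i), b < nleaves (c i)) F i a b
    = \matrix_(a, b) (('X - (N i)%:P) *+ (a == b)
        - (laplacian R (nleaves (c i)) (adjT (c i)) a b)%:P).
  apply/matrixP=> a b.
  by rewrite laplacianE ?mxE //; apply: adjT_irreflexive.
have detD : \det D = \prod_(i < size cs)
    (char_poly (laplacian R (nleaves (c i)) (adjT (c i))) \Po ('X - (N i)%:P)).
  rewrite det_blocks size_map; apply: eq_bigr => i _.
  by rewrite (nth_map SLeaf) // comp_char_polyE FE.
(* Rows of a child Laplacian sum to zero, so only the scalar [X - N_i] survives. *)
have F_row i a : (a < nleaves (c i))%N ->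
    \sum_(b < nleaves (c i)) F i a b = 'X - (N i)%:P.
  move=> alt; rewrite sumrB (bigD1 (Ordinal alt)) //= eqxx mulr1n.
  rewrite [X in _ + X - _]big1 ?addr0 => [|b ba]; last by rewrite [a == b]eq_sym (negPf (ba : b != a :> nat)).
  rewrite -rmorph_sum /= -[RHS]subr0; congr (_ - _); apply/eqP; rewrite polyC_eq0.
  apply/eqP; rewrite -[RHS](laplacian_row_sum R _ (adjT (c i)) (Ordinal alt)).
    by rewrite laplacianE; [apply: eq_bigr => b _; rewrite mxE | apply: adjT_irreflexive].
  exact: adjT_irreflexive.
(* [D] sends the indicator of a block to its row sums, which are constant on that block. *)
have DZ : D *m Z = Z *m C.
  rewrite mul_mx_diag; apply/matrixP=> x i; rewrite !mxE.
  pose G j b : {poly R} :=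
    (if bidx ns x == j then F (bidx ns x) (bpos ns x) b else 0) * (j == i)%:R.
  transitivity (\sum_(y < sumn ns) G (bidx ns y) (bpos ns y)).
    by apply: eq_bigr => y _; rewrite !mxE.
  rewrite sum_children (bigD1 i) //= [X in _ + X]big1 ?addr0 => [|j ji]; last first.
    by rewrite big1 // => b _; rewrite /G (negPf (ji : j != i :> nat)) mulr0.
  rewrite /G eqxx; case: eqP => [xi|_]; last by rewrite [RHS]mul0r big1 // => b _; rewrite mul0r.
  rewrite mul1r; under eq_bigr do rewrite mulr1.
  rewrite xi F_row // /c -xi; have := bpos_lt _ _ (ltn_ord x).
  by rewrite (nth_map SLeaf) // bidx_cs.
(* Summing a row of [W] over block [j] multiplies its constant value there by the number of leaves
   of [j]. *)
have WZ : C + W *m Z = \matrix_(i < size cs, j < size cs)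
    (('X - (N i)%:P) *+ (i == j) + ((i != j) && e i j)%:R *+ nleaves (c j)).
  apply/matrixP=> i j; rewrite !mxE; congr (_ + _).
  pose G l (b : nat) : {poly R} := ((i != l :> nat) && e i l)%:R * (l == j)%:R.
  transitivity (\sum_(y < sumn ns) G (bidx ns y) (bpos ns y)).
    by apply: eq_bigr => y _; rewrite !mxE.
  rewrite sum_children (bigD1 j) //= [X in _ + X]big1 ?addr0 => [|l lj]; last first.
    by rewrite big1 // => b _; rewrite /G (negPf (lj : l != j :> nat)) mulr0.
  by rewrite /G sumr_const card_ord eqxx mulr1.
(* Adjacency between different blocks depends on the blocks alone and is carried by [Z W]; the
   external part [N_i] of the degree sits in [D]. *)
have AE : char_poly_mx (laplacian R (sumn ns) (adjT (SNode cs e))) = D + Z *m W.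
  rewrite laplacianE; last exact: adjT_irreflexive.
  apply/matrixP=> x y; have ilt := bidx_cs _ (ltn_ord x).
  have -> : (D + Z *m W) x y = D x y + W (Ordinal ilt) y.
    rewrite !mxE (bigD1 (Ordinal ilt)) //= !mxE eqxx mul1r.
    rewrite [X in _ + (_ + X)]big1 ?addr0 // => i ix.
    by rewrite mxE [_ == i :> nat]eq_sym (negPf (ix : i != bidx ns x :> nat)) mul0r.
  rewrite !mxE degree_node // adjT_node //= -/ns.
  have [eq_i|ne_i] := eqVneq (bidx ns x) (bidx ns y); last first.
    have -> : (x == y) = false by apply: contraNF ne_i => /eqP->.
    have -> : (x == y :> nat) = false by apply: contraNF ne_i => /eqP->.
    by rewrite !mulr0n !sub0r add0r polyCN opprK rmorph_nat.
  (* Within one block, a vertex is determined by its offset. *)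
  have -> : (x == y) = (bpos ns x == bpos ns y).
    apply/eqP/eqP=> [->//|eq_p]; apply/val_inj.
    exact: (bidx_bpos_inj ns) eq_i eq_p _ _.
  have -> : (x == y :> nat) = (bpos ns x == bpos ns y).
    apply/eqP/eqP=> [->//|eq_p].
    exact: (bidx_bpos_inj ns) eq_i eq_p _ _.
  rewrite /F /Lc addr0; case: (_ == _); rewrite ?mulr1n ?mulr0n ?sub0r //.
  by rewrite -/(N _) !polyCB !polyCD opprB !opprD !opprK; ring.
rewrite /char_poly -[nleaves _]/(sumn ns) AE.
rewrite -WZ -detD -(det_add_mul_stable _ _ _ _ _ _ _ DZ).
by rewrite det_diag; congr (_ * _); apply: eq_bigr => i _; rewrite mxE.
Qed.

(** * Shifted spectra and induction on the tree *)

Lemma calL_sym (R : rcfType) cs e :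
  simple_on (size cs) e -> (calL R cs e)^T = calL R cs e.
Proof.
move=> e_simple; apply/matrixP=> i j; rewrite !mxE eq_sym; case: eqP => [->//|_].
by rewrite (simple_on_sym _ _ j i e_simple) // mulnC.
Qed.

(** The vector of the [sqrt(n_i)] lies in the kernel, and [i0] witnesses that it is nonzero. This is
    the zero that [phi] removes. *)
Lemma calL_spectrum0 (R : rcfType) cs e (i0 : 'I_(size cs)) :
  (forall i, (i < size cs)%N -> (0 < nleaves (nth SLeaf cs i))%N) ->
  simple_on (size cs) e -> 0 \in spectrum (calL R cs e).
Proof.
move=> n_gt0 e_simple.
rewrite -root_prod_XsubC symmetric_spectrum_prod ?calL_sym // -eigenvalue_root_char.
pose r (i : 'I_(size cs)) : R := Num.sqrt (nleaves (nth SLeaf cs i))%:R.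
have rr i : r i * r i = (nleaves (nth SLeaf cs i))%:R by rewrite -expr2 sqr_sqrtr ?ler0n.
apply/eigenvalueP; exists (\row_i r i); last first.
  apply/eqP=> /rowP/(_ i0)/eqP.
  by rewrite !mxE sqrtr_eq0 leNgt ltr0n n_gt0.
rewrite scale0r; apply/rowP=> j; rewrite !mxE (bigD1 j) //= !mxE eqxx.
rewrite /Nval mulr_sumr big_mkcondr -big_split /= big1 // => i ij.
rewrite !mxE -val_eqE (negPf ij); case: (e i j); last by rewrite mulr0 addr0.
by rewrite natrM sqrtrM ?ler0n // -/(r i) -/(r j) mulrN mulrA rr mulrC subrr.
Qed.

(** The zero dropped by [phi] would have been shifted to [s]; the factor [X - s] restores it. *)
Lemma phi_prod (R : rcfType) (s : R) (w : seq R) : 0 \in w ->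
  \prod_(x <- phi s w) ('X - x%:P) * ('X - s%:P)
    = (\prod_(x <- w) ('X - x%:P)) \Po ('X - s%:P).
Proof.
move=> w0; rewrite /phi w0 big_map (perm_big _ (perm_to_rem w0)) big_cons /=.
rewrite mulrC rmorphM /= subr0 comp_polyX rmorph_prod /=; congr (_ * _).
apply: eq_bigr => x _; rewrite rmorphB /= comp_polyX comp_polyC polyCD.
by rewrite opprD addrA addrAC.
Qed.

Lemma contrib_node (R : rcfType) isroot cs e (s : R) :
  contrib isroot (SNode cs e) s =
    (if isroot then spectrum (calL R cs e) else phi s (spectrum (calL R cs e)))
    ++ flatten [seq contrib false (nth SLeaf cs i) (s + Nval R cs e i)
               | i <- iota 0 (size cs)].
Proof.
(* The start index [m] is generalized because the inner recursion increments it. *)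
have goE (G : nat -> R) : forall l m,
    (fix go (l : seq stree) (i : nat) : seq R :=
       if l is c :: l' then contrib false c (G i) ++ go l' i.+1 else [::]) l m
    = flatten [seq contrib false (nth SLeaf l i) (G (m + i)%N) | i <- iota 0 (size l)].
  elim=> //= c l IHl m; rewrite addn0 IHl (iotaDl 1 0) -map_comp.
  by congr (_ ++ flatten _); apply: eq_map => i /=; rewrite addnS.
by rewrite /= (goE (fun i => s + Nval R cs e i)).
Qed.

Lemma contrib_prod (R : rcfType) isroot cs e (s : R) :
  \prod_(x <- contrib isroot (SNode cs e) s) ('X - x%:P) =
    \prod_(x <- if isroot then spectrum (calL R cs e) else phi s (spectrum (calL R cs e)))
       ('X - x%:P)
    * \prod_(i < size cs)
        \prod_(x <- contrib false (nth SLeaf cs i) (s + Nval R cs e i)) ('X - x%:P).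
Proof.
rewrite contrib_node big_cat big_flatten big_map; congr (_ * _).
have -> : iota 0 (size cs) = index_iota 0 (size cs) by rewrite /index_iota subn0.
by rewrite big_mkord.
Qed.

(** Induction invariant: below the root, the contributions form the child spectrum shifted by [s],
    short of one [s]. A leaf contributes nothing, matching its characteristic polynomial [X]. *)
Lemma contrib_char_poly (R : rcfType) t (s : R) : wf_conn t ->
  \prod_(x <- contrib false t s) ('X - x%:P) * ('X - s%:P)
    = char_poly (laplacian R (nleaves t) (adjT t)) \Po ('X - s%:P).
Proof.
elim/stree_nth_ind: t s => [s _|cs e IH s].
  rewrite big_nil mul1r /char_poly det_mx11 !mxE eqxx mulr1n.
  rewrite (_ : #|_| = 0%N) ?subr0 ?comp_polyX //.
  by apply: eq_card0 => k; rewrite inE.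
case/and4P=> cs_gt1 cs_wf e_simple _.
have c_wf i : (i < size cs)%N -> wf_conn (nth SLeaf cs i).
  by move=> ilt; apply: (all_nthP SLeaf cs_wf).
have n_gt0 i : (i < size cs)%N -> (0 < nleaves (nth SLeaf cs i))%N.
  by move/c_wf/wf_nleaves_gt0.
have S0 := calL_spectrum0 R cs e (Ordinal (ltnW cs_gt1)) n_gt0 e_simple.
rewrite contrib_prod mulrAC phi_prod // symmetric_spectrum_prod ?calL_sym //.
(* [K] collects the factors missing from the children, each shifted by its own accumulated
   valency. *)
pose K := \prod_(i < size cs) ('X - (s + Nval R cs e i)%:P).
have K_neq0 : K != 0 by rewrite monic_neq0 // monic_prod_XsubC.
apply: (mulIf K_neq0).
have -> : K = (\prod_(i < size cs) ('X - (Nval R cs e i)%:P)) \Po ('X - s%:P).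
  rewrite rmorph_prod; apply: eq_bigr => i _ /=.
  by rewrite rmorphB /= comp_polyX comp_polyC polyCD opprD addrA.
rewrite -[RHS]rmorphM /= char_poly_node // rmorphM /= [RHS]mulrC -mulrA.
congr (_ * _); rewrite !rmorph_prod -big_split /=; apply: eq_bigr => i _.
(* Composing the substitutions by [N_i] and by [s] produces the shift [s + N_i] of the child. *)
rewrite rmorphB /= comp_polyX comp_polyC -comp_polyA rmorphB /= comp_polyX comp_polyC.
by rewrite -addrA -opprD -polyCD IH // c_wf.
Qed.

Theorem mainTheorem3 (R : rcfType) (t : stree) :
  wf_conn t -> (2 <= nleaves t)%N ->
  perm_eq (spectrum (laplacian R (nleaves t) (adjT t))) (rhs_spectrum R t).
Proof.
case: t => // cs e /and4P[_ cs_wf e_simple _] _; apply: spectrum_of_splits.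
have c_wf i : (i < size cs)%N -> wf_conn (nth SLeaf cs i).
  by move=> ilt; apply: (all_nthP SLeaf cs_wf).
rewrite contrib_prod symmetric_spectrum_prod ?calL_sym //.
(* At the root [s = 0]: the factors missing from the children are exactly those on the left of
   [char_poly_node]. *)
pose K := \prod_(i < size cs) ('X - (Nval R cs e i)%:P).
have K_neq0 : K != 0 by rewrite monic_neq0 // monic_prod_XsubC.
apply: (mulIf K_neq0).
rewrite char_poly_node // => [|i /c_wf/wf_nleaves_gt0 //].
rewrite [LHS]mulrC -mulrA; congr (_ * _).
rewrite -big_split; apply: eq_bigr => i _ /=.
by rewrite add0r contrib_char_poly // c_wf.
Qed.
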